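(* Let $\varphi\in\mathcal{S}(\mathbb{R})$ with $\varphi(x)>0$ for all $x$, and suppose there exist constants $a>0$ and $C>0$ such that $\varphi(x)\le C\,e^{-a|x|}$ for all $x\in\mathbb{R}$. Let $f_1,f_2$ be measurable functions on $\mathbb{R}$ with $f_1-f_2\in L^2(\mathbb{R},\varphi(x)\,dx)$. If the integrals below exist (absolutely convergent) and $$\int_{\mathbb{R}}x^nf_1(x)\varphi(x)\,dx=\int_{\mathbb{R}}x^nf_2(x)\varphi(x)\,dx\qquad\text{for all }n\ge0,$$ then $f_1=f_2$ almost everywhere.
   Context: $\mathcal{S}(\mathbb{R})$ is the Schwartz space of rapidly decreasing smooth functions. *)

(* Defs.v *)
From HB Require Import structures.
From mathcomp Require Import all_boot all_order all_algebra.
From mathcomp Require Import all_classical all_reals all_analysis.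
From mathcomp Require Import complex.

Set Implicit Arguments.
Unset Strict Implicit.
Unset Printing Implicit Defensive.

Import Order.TTheory GRing.Theory Num.Theory.
Import numFieldNormedType.Exports.

Local Open Scope classical_set_scope.
Local Open Scope ring_scope.
Local Open Scope complex_scope.

Definition smooth (R : realType) (phi : R -> R) : Prop :=
  forall (n : nat) (x : R), derivable (derive1n n phi) x 1.

(* The real-valued elements of S(R). *)
Definition schwartz (R : realType) (phi : R -> R) : Prop :=
  smooth phi /\
  forall k n : nat, exists M : R, forall x : R,
    `|x ^+ k * derive1n n phi x| <= M.

(* A copy of R carrying the sigma-algebra of Lebesgue measurable sets, whereas
   R itself carries the Borel sigma-algebra. *)
Definition lebesgueR (R : realType) :=
  caratheodory_type ((wlength (R := R) idfun)^*)%mu.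

Section complex_integration.
Context d (T : measurableType d) (R : realType).
Variable mu : {measure set T -> \bar R}.
Implicit Types f : T -> R[i].

Definition cmeasurable f : Prop :=
  measurable_fun setT (fun x => complex.Re (f x)) /\
  measurable_fun setT (fun x => complex.Im (f x)).

Definition cintegrable f : Prop :=
  cmeasurable f /\ (\int[mu]_x (Normc.normc (f x))%:E < +oo)%E.

Definition cintegral f : R[i] :=
  (\int[mu]_x complex.Re (f x)) +i* (\int[mu]_x complex.Im (f x)).

(* Membership in L^2(w dmu) for a nonnegative measurable weight w. *)
Definition L2_weight (w : T -> R) f : Prop :=
  cmeasurable f /\ (\int[mu]_x (Normc.normc (f x) ^+ 2 * w x)%:E < +oo)%E.

End complex_integration.

(* Main.v *)
(* Put h = (f1 - f2) phi, real and imaginary parts separately. By AM-GM the L2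
   hypothesis and the decay of phi make h e^{b|x|} integrable for b = a/4, and
   all moments of h vanish. Call a bounded function w a multiplier when h w
   keeps these two properties for every h that has them. Multipliers form an
   algebra closed under uniformly bounded pointwise limits. Expanding in power
   series, sin(sx) and cos(sx) are multipliers for |s| <= b/2, hence so is
   sin(s(x - y)), hence its sign (a bounded limit of polynomials in it), hence
   sgn(x - y) by letting s tend to 0, hence the indicator of every ray and, by
   the sigma-algebra argument, of every Borel set. So h integrates to 0 over
   every Borel set and vanishes almost everywhere; no Fourier inversion or
   analytic continuation is involved. *)
Require Import Defs.
From HB Require Import structures.
From mathcomp Require Import all_boot all_order all_algebra.
From mathcomp Require Import all_classical all_reals all_analysis.
From mathcomp Require Import complex measurable_realfun.
From mathcomp Require Import ring lra.

Set Implicit Arguments.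
Unset Strict Implicit.
Unset Printing Implicit Defensive.

Import Order.TTheory GRing.Theory Num.Theory.
Import numFieldNormedType.Exports.

Local Open Scope classical_set_scope.
Local Open Scope ring_scope.
Local Open Scope complex_scope.

(** * Domination of powers and partial sums by the exponential *)

Section exp_bounds.
Context {R : realType}.
Implicit Types (x b : R) (n : nat).

Lemma series_exp_coeff_le_expR x n : 0 <= x -> series (exp_coeff x) n <= expR x.
Proof.
move=> x0; apply: nondecreasing_cvgn_le; last exact: is_cvg_series_exp_coeff.
apply/nondecreasing_seqP => k; rewrite /series /= big_nat_recr//= lerDl.
exact: exp_coeff_ge0.
Qed.

(** A single term [(b * |x|)^n / n!] of the exponential series is at most its sum, which gives the
    constant [n! / b^n]. *)
Lemma exprn_le_expR b n : 0 < b ->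
  exists2 C, 0 <= C & forall x, `|x| ^+ n <= C * expR (b * `|x|).
Proof.
move=> b0; exists (n`!%:R / b ^+ n) => [|x].
  by rewrite divr_ge0// exprn_ge0// ltW.
have bx0 : 0 <= b * `|x| by rewrite mulr_ge0// ltW.
have : (b * `|x|) ^+ n / n`!%:R <= expR (b * `|x|).
  case: n => [|n]; last first.
    by apply: le_trans (expR_ge1Dxn n bx0); rewrite lerDr.
  by rewrite expr0 fact0 divr1 (le_trans _ (expR_ge1Dx _))// lerDl.
rewrite exprMn ler_pdivrMr ?ltr0n ?fact_gt0// => /le_trans le.
rewrite mulrAC ler_pdivlMr ?exprn_gt0// mulrC.
by rewrite (le_trans (le _ (lexx _)))// mulrC.
Qed.

End exp_bounds.

(** * Integrable functions of integral zero *)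

Section null_integral.
Context d (T : measurableType d) (R : realType).
Variable mu : {measure set T -> \bar R}.
Implicit Types f g : T -> R.

Definition null_integral f :=
  mu.-integrable setT (EFin \o f) /\ \int[mu]_x f x = 0.

Lemma le_integrable_EFin f g : measurable_fun setT f ->
  (forall x, `|f x| <= g x) -> mu.-integrable setT (EFin \o g) ->
  mu.-integrable setT (EFin \o f).
Proof.
move=> mf fg; apply: le_integrable => //; first exact/measurable_EFinP.
by move=> x _; rewrite lee_fin (le_trans (fg x))// ler_norm.
Qed.

Lemma null_integralD f g : null_integral f -> null_integral g ->
  null_integral (fun x => f x + g x).
Proof.
move=> [fi f0] [gi g0]; split.
  by rewrite (_ : _ \o _ = (EFin \o f) \+ (EFin \o g))//; exact: integrableD.
by rewrite RintegralD// f0 g0 addr0.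
Qed.

Lemma null_integralZ c f : null_integral f -> null_integral (fun x => c * f x).
Proof.
move=> [fi f0]; split.
  rewrite (_ : _ \o _ = (fun x => c%:E * (EFin \o f) x))%E//.
  exact: integrableZl.
by rewrite RintegralZl// f0 mulr0.
Qed.

Lemma null_integral_sum (f : nat -> T -> R) n :
  (forall k, null_integral (f k)) ->
  null_integral (fun x => \sum_(0 <= k < n) f k x).
Proof.
move=> f0; elim: n => [|n ih].
  rewrite (_ : (fun _ => _) = cst 0); last first.
    by apply/funext => x; rewrite big_geq.
  split; first exact: integrable0.
  by rewrite /Rintegral integral0.
rewrite (_ : (fun _ => _) = fun x => \sum_(0 <= k < n) f k x + f n x).
  exact: null_integralD.
by apply/funext => x; rewrite big_nat_recr.
Qed.

(** Dominated convergence, in the form used both for power series and for limits of multipliers. *)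
Lemma null_integral_cvg (f_ : nat -> T -> R) f g :
  mu.-integrable setT (EFin \o g) ->
  (forall n x, `|f_ n x| <= g x) ->
  (forall x, f_ ^~ x @ \oo --> f x) ->
  (forall n, null_integral (f_ n)) -> null_integral f.
Proof.
move=> gi f_g f_f f_0.
have mf_ n : measurable_fun setT (f_ n).
  by apply/measurable_EFinP; exact: measurable_int (f_0 n).1.
have mf : measurable_fun setT f.
  by apply: (measurable_fun_cvg mf_) => x _; exact: f_f.
have [|||||fi _] := @dominated_convergence _ _ _ mu _ measurableT
  (fun n => EFin \o f_ n) (EFin \o f) (EFin \o g).
- by move=> n; exact/measurable_EFinP.
- exact/measurable_EFinP.
- by apply: aeW => x _; apply: cvg_EFin; [exact: nearW|exact: f_f].
- exact: gi.
- by apply: aeW => x n _; rewrite lee_fin.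
rewrite (_ : [sequence _]_n = cst 0%E); last first.
  apply/funext => n /=; have [fni fn0] := f_0 n.
  (* [Rintegral] is [fine] of the extended integral, and [fine] sends infinite values to 0;
     integrability makes the zero genuine. *)
  by rewrite -[LHS]fineK ?integrable_fin_num//; congr EFin.
move=> /cvg_lim; rewrite lim_cst// => f0; split => //.
by rewrite /Rintegral -f0.
Qed.

End null_integral.

(** * Approximating the sign function by polynomials and by sines *)

Section sign_iteration.
Context {R : realType}.
Implicit Types p t : R.

(* Newton's iteration for the sign function; each iterate is an odd polynomial
   in [p] mapping [-1, 1] to itself. *)
Definition sg_iter p n := iter n (fun q => q * (3 - q ^+ 2) / 2) p.

Lemma sg_iterN p n : sg_iter (- p) n = - sg_iter p n.
Proof. by elim: n => //= n ->; rewrite sqrrN !mulNr. Qed.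

Lemma sg_iter_itv p n : 0 <= p <= 1 -> 0 <= sg_iter p n <= 1.
Proof.
move=> p01; elim: n => //= n /andP[q0 q1]; set q := sg_iter p n in q0 q1 *.
apply/andP; split; first by rewrite divr_ge0// mulr_ge0//; nra.
(* The product is twice [1 - q * (3 - q ^+ 2) / 2]. *)
suff : 0 <= (1 - q) ^+ 2 * (q + 2) by lra.
by rewrite mulr_ge0 ?sqr_ge0// addr_ge0.
Qed.

Lemma norm_sg_iter p n : `|p| <= 1 -> `|sg_iter p n| <= 1.
Proof.
have ge0 q : 0 <= q -> `|q| <= 1 -> `|sg_iter q n| <= 1.
  move=> q0; rewrite ger0_norm// => q1.
  have /andP[? ?] := @sg_iter_itv q n (introT andP (conj q0 q1)).
  by rewrite ger0_norm.
have [p0|/ltW p0] := leP 0 p; first exact: ge0.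
by move=> p1; rewrite -normrN -sg_iterN ge0 ?normrN// oppr_ge0.
Qed.

(** The iterates increase and stay below 1, so they converge to a fixed point of the iteration that
    is at least [p]. The fixed points are -1, 0 and 1, and only 1 is positive. *)
Lemma cvg_sg_iter_gt0 p : 0 < p <= 1 -> sg_iter p @ \oo --> (1 : R).
Proof.
move=> /andP[p0 p1]; have q01 n : 0 <= sg_iter p n <= 1.
  by rewrite sg_iter_itv// ltW.
have nd : nondecreasing_seq (sg_iter p).
  apply/nondecreasing_seqP => n /=; have /andP[q0 q1] := q01 n.
  set q := sg_iter p n in q0 q1 *.
  (* One iteration adds half of this quantity to [q]. *)
  suff : 0 <= q * (1 - q ^+ 2) by lra.
  by rewrite mulr_ge0// subr_ge0 expr_le1.
have cq : cvgn (sg_iter p).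
  apply: nondecreasing_is_cvgn => //; exists 1 => _ [n _ <-].
  by case/andP: (q01 n).
have pl : p <= limn (sg_iter p) by exact: (nondecreasing_cvgn_le nd cq 0%N).
set l := limn _ in pl; have ql : sg_iter p @ \oo --> l by [].
suff -> : 1 = l by [].
have l_fix : l = l * (3 - l ^+ 2) / 2.
  have qSl : [sequence sg_iter p n.+1]_n @ \oo --> l by rewrite cvg_shiftS.
  rewrite -[LHS](cvg_lim _ qSl)//; apply/cvg_lim => //.
  apply: cvgM; last exact: cvg_cst; apply: cvgM => //.
  by apply: cvgB; [exact: cvg_cst|rewrite expr2; exact: cvgM].
have l0 : 0 < l by exact: lt_le_trans pl.
have : l * ((1 - l) * (1 + l)) = 0 by lra.
by move=> /eqP; rewrite !mulf_eq0 => /or3P[] /eqP; lra.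
Qed.

Lemma cvg_sg_iter p : `|p| <= 1 -> sg_iter p @ \oo --> Num.sg p.
Proof.
rewrite ler_norml => /andP[pN1 p1]; have [->|p0|p0] := sgrP p.
- rewrite (_ : sg_iter 0 = cst 0); first exact: cvg_cst.
  apply/funext => n; elim: n => //= n.
  by rewrite /sg_iter /= => ->; rewrite !mul0r.
- by apply: cvg_sg_iter_gt0; rewrite p0.
- rewrite (_ : sg_iter p = \- (sg_iter (- p))).
    by apply: cvgN; apply: cvg_sg_iter_gt0; rewrite oppr_gt0 p0/= lerNl.
  by apply/funext => n /=; rewrite sg_iterN opprK.
Qed.

Lemma cvg_sg_sin c t : 0 < c ->
  (fun n => Num.sg (sin (c / n.+1%:R * t))) @ \oo --> Num.sg t.
Proof.
move=> c0; have [->|t0] := eqVneq t 0.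
  rewrite (_ : (fun _ => _) = cst (Num.sg 0)); first exact: cvg_cst.
  by apply/funext => n; rewrite mulr0 sin0.
apply: cvg_near_cst; near=> n.
(* By oddness the sign of [t] leaves the sine. The remaining argument [c * |t| / (n + 1)] eventually
   lies strictly between 0 and pi, so the sequence is eventually constant. *)
rewrite {1}[t]numEsg mulrCA sin_sg sgrM sgr_id [Num.sg (sin _)]gtr0_sg ?mulr1//.
rewrite sin_gt0_pi//.
rewrite mulr_gt0 ?normr_gt0 ?divr_gt0//= mulrAC ltr_pdivrMr//.
rewrite -ltr_pdivrMl ?pi_gt0// (@lt_trans _ _ n%:R) ?ltr_nat//.
by near: n; exact: nbhs_infty_gtr.
Unshelve. all: by end_near. Qed.

End sign_iteration.

(** * Multipliers preserving the vanishing of all moments *)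

Section multiplier.
Context d (T : measurableType d) (R : realType).
Variables (mu : {measure set T -> \bar R}) (X : T -> R) (b : R).
Hypotheses (mX : measurable_fun setT X) (b0 : 0 < b).
Implicit Types h w : T -> R.

(** The exponential weight makes every moment absolutely convergent, and leaves room for the power
    series of sine and cosine. [X] will be the identity from the Lebesgue line to the Borel line. *)
Definition null_moments h :=
  mu.-integrable setT (EFin \o (fun x => h x * expR (b * `|X x|))) /\
  forall n, \int[mu]_x (X x ^+ n * h x) = 0.

(** Boundedness preserves the exponential integrability. Since all [h] are quantified over, two
    multipliers can be applied one after the other, whence closure under products. *)
Definition multiplier w :=
  [/\ measurable_fun setT w, (exists M, forall x, `|w x| <= M) &
      forall h, null_moments h -> null_moments (fun x => h x * w x)].

Lemma measurable_exp_norm c : measurable_fun setT (fun x => expR (c * `|X x|)).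
Proof.
apply: (measurableT_comp (@measurable_expR R)); apply: measurable_funM => //.
exact: measurableT_comp.
Qed.

Lemma null_moments_measurable h : null_moments h -> measurable_fun setT h.
Proof.
move=> [/measurable_int/measurable_EFinP mh _].
rewrite (_ : h = fun x => h x * expR (b * `|X x|) * expR (- b * `|X x|)).
  by apply: measurable_funM => //; exact: measurable_exp_norm.
by apply/funext => x; rewrite mulNr -mulrA expRxMexpNx_1 mulr1.
Qed.

(** The power [X ^+ n] is absorbed by the exponential weight, so linearity and dominated convergence
    become available for the moments. *)
Lemma null_moments_null h n : null_moments h ->
  null_integral mu (fun x => X x ^+ n * h x).
Proof.
move=> h0; split; last exact: h0.2.
have [C C0 XC] := @exprn_le_expR R b n b0.
apply: (@le_integrable_EFin _ _ _ _ _
    (fun x => C * `|h x * expR (b * `|X x|)|)).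
- apply: measurable_funM; last exact: null_moments_measurable.
  exact: measurable_funX.
- move=> x; rewrite normrM normrX normrM (ger0_norm (expR_ge0 _)).
  by rewrite mulrCA mulrC ler_wpM2l.
- rewrite (_ : _ \o _ = fun x => (C%:E * `|h x * expR (b * `|X x|)|%:E)%E)//.
  by apply: integrableZl => //; exact: integrable_norm h0.1.
Qed.

Lemma null_moments_bounded_int h w : null_moments h ->
  measurable_fun setT w -> (exists M, forall x, `|w x| <= M) ->
  mu.-integrable setT (EFin \o (fun x => h x * w x * expR (b * `|X x|))).
Proof.
move=> [hi _] mw [M wM].
rewrite (_ : _ \o _ = (EFin \o (fun x => (h x * expR (b * `|X x|))%R)) \*
  (EFin \o w))%E; last by apply/funext => x /=; rewrite -EFinM mulrAC.
apply: integrableMl => //; exists M; split; first exact: num_real.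
by move=> r Mr x _; exact: le_trans (wM x) (ltW Mr).
Qed.

Lemma multiplier_cst c : multiplier (cst c).
Proof.
have mc : measurable_fun setT (cst c : T -> R) by exact: measurable_cst.
have cM : exists M, forall x : T, `|cst c x| <= M by exists `|c|.
split => // h h0; split; first exact: null_moments_bounded_int.
move=> n; have [_] := null_integralZ c (null_moments_null n h0).
move=> e; rewrite -[RHS]e.
by apply: eq_Rintegral => x _ /=; ring.
Qed.

Lemma multiplierD w1 w2 : multiplier w1 -> multiplier w2 ->
  multiplier (fun x => w1 x + w2 x).
Proof.
move=> [mw1 [M1 wM1] w1h] [mw2 [M2 wM2] w2h].
have mw : measurable_fun setT (fun x => w1 x + w2 x) by exact: measurable_funD.
have wM : exists M, forall x, `|w1 x + w2 x| <= M.
  by exists (M1 + M2) => x; rewrite (le_trans (ler_normD _ _))// lerD.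
split => // h h0; split; first exact: null_moments_bounded_int.
move=> n; have [_] := null_integralD (null_moments_null n (w1h _ h0))
  (null_moments_null n (w2h _ h0)).
move=> e; rewrite -[RHS]e; by apply: eq_Rintegral => x _; rewrite -!mulrDr.
Qed.

Lemma multiplierM w1 w2 : multiplier w1 -> multiplier w2 ->
  multiplier (fun x => w1 x * w2 x).
Proof.
move=> [mw1 [M1 wM1] w1h] [mw2 [M2 wM2] w2h]; split.
- exact: measurable_funM.
- by exists (M1 * M2) => x; rewrite normrM ler_pM.
- move=> h h0; rewrite (_ : (fun _ => _) = fun x => h x * w1 x * w2 x).
    exact/w2h/w1h.
  by apply/funext => x; rewrite mulrA.
Qed.

(** The bound 1 makes [|X ^+ n * h|] a majorant for every moment integrand along the sequence. *)
Lemma multiplier_cvg (w_ : nat -> T -> R) w :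
  (forall n, multiplier (w_ n)) -> (forall n x, `|w_ n x| <= 1) ->
  (forall x, w_ ^~ x @ \oo --> w x) -> multiplier w.
Proof.
move=> w_m w_1 w_w.
have mw : measurable_fun setT w.
  apply: (@measurable_fun_cvg _ _ _ _ w_) => [n|x _]; last exact: w_w.
  by case: (w_m n).
have w1 x : `|w x| <= 1.
  have /cvg_lim <-// : (fun n => `|w_ n x|) @ \oo --> `|w x|.
    by apply: cvg_norm; exact: w_w.
  apply: limr_le; first by apply: is_cvg_norm; apply/cvg_ex; exists (w x).
  exact: nearW.
have wM : exists M, forall x, `|w x| <= M by exists 1.
split => // h h0; split; first exact: null_moments_bounded_int.
move=> n; suff [] : null_integral mu (fun x => X x ^+ n * (h x * w x)) by [].
apply: (@null_integral_cvg _ _ _ mu (fun k x => X x ^+ n * (h x * w_ k x)) _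
    (fun x => `|X x ^+ n * h x|)).
- exact/integrable_norm/(null_moments_null n h0).1.
- by move=> k x; rewrite mulrA normrM ler_piMr.
- by move=> x; do 2 (apply: cvgM; first exact: cvg_cst); exact: w_w.
- by move=> k; apply: null_moments_null; have [_ _] := w_m k; exact.
Qed.

(** Against [X ^+ n * h] each partial sum integrates to a combination of moments, that is to 0. Half
    of the exponent [b] dominates [X ^+ n]; the other half dominates the partial sums, which are
    bounded by [expR |s * X|] because the [c k] are at most 1 in absolute value. *)
Lemma multiplier_power_series (c : nat -> R) (f : R -> R) s :
  (forall k, `|c k| <= 1) ->
  (forall x, series (fun k => c k * x ^+ k / k`!%:R) @ \oo --> f x) ->
  (forall x, `|f x| <= 1) -> measurable_fun setT f ->
  `|s| <= b / 2 -> multiplier (fun x => f (s * X x)).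
Proof.
move=> c1 cf f1 mf sb.
have b20 : 0 < b / 2 by rewrite divr_gt0.
have mw : measurable_fun setT (fun x => f (s * X x)).
  by apply: (measurableT_comp mf); exact: measurable_funM.
have wM : exists M, forall x, `|f (s * X x)| <= M by exists 1.
split => // h h0; split; first exact: null_moments_bounded_int.
move=> n; suff [] : null_integral mu (fun x => X x ^+ n * (h x * f (s * X x)))
  by [].
have [C C0 XC] := @exprn_le_expR R (b / 2) n b20.
apply: (@null_integral_cvg _ _ _ mu
    (fun N x => X x ^+ n *
      (h x * series (fun k => c k * (s * X x) ^+ k / k`!%:R) N)) _
    (fun x => C * `|h x * expR (b * `|X x|)|)).
- rewrite (_ : _ \o _ = fun x => (C%:E * `|h x * expR (b * `|X x|)|%:E)%E)//.
  by apply: integrableZl => //; exact: integrable_norm h0.1.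
- move=> N x; set S := series _ N.
  have SX : `|S| <= expR (b / 2 * `|X x|).
    apply: (@le_trans _ _ (expR `|s * X x|)).
      apply: le_trans (series_exp_coeff_le_expR N (normr_ge0 _)).
      rewrite (le_trans (ler_norm_sum _ _ _))// ler_sum// => k _.
      rewrite /exp_coeff /= !normrM normfV normr_nat normrX normrM.
      by rewrite -mulrA ler_piMl// divr_ge0// exprn_ge0// mulr_ge0.
    by rewrite ler_expR normrM ler_wpM2r.
  rewrite normrM normrX normrM normrM (ger0_norm (expR_ge0 _)).
  rewrite mulrCA [leRHS]mulrCA ler_wpM2l//.
  have -> : b * `|X x| = b / 2 * `|X x| + b / 2 * `|X x| by field.
  by rewrite expRD mulrA ler_pM.
- by move=> x; do 2 (apply: cvgM; first exact: cvg_cst); exact: cf.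
- move=> N.
  (* The [k]-th term of the partial sum contributes a multiple of the moment of order [n + k]. *)
  rewrite (_ : (fun _ => _) = fun x => \sum_(0 <= k < N)
      (c k * s ^+ k / k`!%:R) * (X x ^+ (n + k) * h x)).
    apply: (null_integral_sum (f := fun k x =>
      (c k * s ^+ k / k`!%:R) * (X x ^+ (n + k) * h x))) => k.
    by apply: null_integralZ; exact: null_moments_null.
  apply/funext => x; rewrite /series /= !mulr_sumr; apply: eq_bigr => k _.
  by rewrite exprD exprMn; ring.
Qed.

Lemma multiplier_sin s : `|s| <= b / 2 -> multiplier (fun x => sin (s * X x)).
Proof.
apply: (@multiplier_power_series (fun k => (odd k)%:R * (-1) ^+ k.-1./2)).
- move=> k; rewrite normrM normrX normrN1 expr1n mulr1.
  by case: odd; rewrite ?normr1 ?normr0.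
- by move=> x; rewrite sin.unlock; exact: is_cvg_series_sin_coeff.
- exact: sin_max.
- exact: continuous_measurable_fun (@continuous_sin R).
Qed.

Lemma multiplier_cos s : `|s| <= b / 2 -> multiplier (fun x => cos (s * X x)).
Proof.
apply: (@multiplier_power_series (fun k => (~~ odd k)%:R * (-1) ^+ k./2)).
- move=> k; rewrite normrM normrX normrN1 expr1n mulr1.
  by case: odd; rewrite ?normr1 ?normr0.
- by move=> x; rewrite cos.unlock; exact: is_cvg_series_cos_coeff.
- exact: cos_max.
- exact: continuous_measurable_fun (@continuous_cos R).
Qed.

Lemma multiplierZ c w : multiplier w -> multiplier (fun x => c * w x).
Proof. by move=> ?; apply: multiplierM => //; exact: multiplier_cst. Qed.

(** The Newton iterates of [w] are polynomials in [w], hence multipliers, and they stay in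
    [-1, 1]. *)
Lemma multiplier_sg w : multiplier w -> (forall x, `|w x| <= 1) ->
  multiplier (fun x => Num.sg (w x)).
Proof.
move=> mw w1; apply: (@multiplier_cvg (fun n x => sg_iter (w x) n)).
- elim=> //= n ih; under eq_fun do rewrite mulrC expr2.
  apply: multiplierZ; apply: multiplierM => //.
  apply: multiplierD; first exact: multiplier_cst.
  under eq_fun do rewrite -mulN1r.
  by apply: multiplierZ; exact: multiplierM.
- by move=> n x; exact: norm_sg_iter.
- by move=> x; exact: cvg_sg_iter.
Qed.

Lemma multiplier_sg_sub y : multiplier (fun x => Num.sg (X x - y)).
Proof.
have b20 : 0 < b / 2 by rewrite divr_gt0.
apply: (@multiplier_cvg (fun n x => Num.sg (sin (b / 2 / n.+1%:R * (X x - y))))).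
- move=> n; apply: multiplier_sg; last by move=> x; exact: sin_max.
  (* The frequencies [b / 2 / (n + 1)] tend to 0 without leaving the range where sine and cosine are
     known to be multipliers; the addition formula then separates [X] from [y]. *)
  set s := b / 2 / _; have sb : `|s| <= b / 2.
    have s0 : 0 < s by rewrite divr_gt0.
    by rewrite gtr0_norm// ler_pdivrMr// ler_peMr ?ler1n// ltW.
  rewrite (_ : (fun _ => _) = fun x =>
    cos (s * y) * sin (s * X x) + - sin (s * y) * cos (s * X x)).
    by apply: multiplierD; apply: multiplierZ;
      [exact: multiplier_sin|exact: multiplier_cos].
  by apply/funext => x; rewrite mulrBr sinB; ring.
- by move=> n x; rewrite normr_sg; case: (_ != _).
- by move=> x; exact: cvg_sg_sin.
Qed.

Lemma multiplier_indic_ray y :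
  multiplier (fun x => \1_(`]y, +oo[%classic : set R) (X x)).
Proof.
(* The polynomial [(t ^+ 2 + t) / 2] is 1 at 1 and vanishes at 0 and -1, so the endpoint [y] is
   excluded, as the open ray requires. *)
rewrite (_ : (fun _ => _) = fun x =>
    2^-1 * (Num.sg (X x - y) * Num.sg (X x - y) + Num.sg (X x - y))).
  apply: multiplierZ; apply: multiplierD; last exact: multiplier_sg_sub.
  by apply: multiplierM; exact: multiplier_sg_sub.
apply/funext => x; rewrite indicE.
have [xy|xy] := ltP y (X x).
  by rewrite mem_set/= ?in_itv/= ?xy// gtr0_sg ?subr_gt0//; field.
rewrite memNset/= ?in_itv/= ?andbT; last by apply/negP; rewrite -leNgt.
move: xy; rewrite le_eqVlt => /predU1P[->|xy].
  by rewrite subrr sgr0 mulr0 addr0 mulr0.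
by rewrite ltr0_sg ?subr_lt0//; field.
Qed.

Lemma multiplier_indic_sigma_algebra :
  sigma_algebra setT [set B : set R | multiplier (fun x => \1_B (X x))].
Proof.
have indicC (B : set R) t : \1_(setT `\` B) t = 1 - \1_B t :> R.
  rewrite !indicE in_setD in_setT andTb.
  by case: (t \in B); rewrite ?subrr ?subr0.
split => /=.
- by rewrite indic0; exact: multiplier_cst.
- move=> B mB; under eq_fun do rewrite indicC -mulN1r.
  by apply: multiplierD; [exact: multiplier_cst|exact: multiplierZ].
- move=> F mF.
  (* These products are the indicators of the complements of finite unions; their limit is the
     indicator of the complement of the whole union. *)
  have mp n : multiplier (fun x => \prod_(0 <= i < n) (1 - \1_(F i) (X x))).
    elim: n => [|n ih].
      by under eq_fun do rewrite big_geq//; exact: multiplier_cst.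
    under eq_fun do rewrite big_nat_recr// -mulN1r.
    apply: multiplierM => //.
    by apply: multiplierD; [exact: multiplier_cst|exact: multiplierZ].
  suff mU : multiplier (fun x => \1_(setT `\` \bigcup_i F i) (X x)).
    under eq_fun do rewrite -[\bigcup_i F i]setCK -setTD indicC -setTD -mulN1r.
    by apply: multiplierD; [exact: multiplier_cst|exact: multiplierZ].
  apply: (multiplier_cvg mp) => [n x|x].
    rewrite normr_prod numdomain.Num.Theory.prodr_ile1// => i _.
    rewrite normr_ge0/= indicE.
    by case: (_ \in _); rewrite ?subrr ?subr0 ?normr0 ?normr1.
  rewrite indicC indicE; have [/set_mem[k _ Fk]|nF] := boolP (_ \in _).
    (* A point of [F k] makes the factor of index [k] zero, and that factor occurs as soon as [n]
       exceeds [k]. *)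
    apply: cvg_near_cst; exists k.+1 => // n /= kn.
    rewrite (bigD1_seq k) ?iota_uniq//= ?mem_index_iota//.
    by rewrite indicE mem_set// subrr mul0r.
  apply: cvg_near_cst; apply: nearW => n.
  rewrite big1 ?subr0// => i _; rewrite indicE memNset ?subr0//.
  by move=> Fi; move/negP: nF; apply; apply/mem_set; exists i.
Qed.

Lemma multiplier_indic (B : set R) : measurable B ->
  multiplier (fun x => \1_B (X x)).
Proof.
move=> mB; have : (@RGenOInfty.G R).-sigma.-measurable B.
  by rewrite -RGenOInfty.measurableE.
apply: (smallest_sub multiplier_indic_sigma_algebra) => _ [y ->].
exact: multiplier_indic_ray.
Qed.

(** This is the moment of order 0 of [h] times the indicator of [B], which is a multiplier. *)
Lemma null_moments_preimage h (B : set R) : null_moments h -> measurable B ->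
  (\int[mu]_(x in X @^-1` B) (h x)%:E = 0)%E.
Proof.
move=> h0 mB; have [_ _ /(_ h h0)hB] := multiplier_indic mB.
have [fi f0] := null_moments_null 0 hB.
rewrite integral_mkcond -[RHS]/(0%:E) -f0 /Rintegral fineK ?integrable_fin_num//.
apply: eq_integral => x _; rewrite patchE expr0 mul1r indicE.
rewrite (_ : (x \in X @^-1` B) = (X x \in B)); last by apply/idP/idP; rewrite !inE.
by case: ifPn; rewrite ?mulr1 ?mulr0.
Qed.

End multiplier.

(** * Passage between the Borel and the Lebesgue sigma-algebras *)

Lemma ge0_integral_image_measure d1 d2 (T1 : measurableType d1)
    (T2 : measurableType d2) (R : realType) (m1 : {measure set T1 -> \bar R})
    (m2 : {measure set T2 -> \bar R}) (g : T1 -> T2) (f : T2 -> R) :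
  measurable_fun setT g ->
  (forall A, measurable A -> m1 (g @^-1` A) = m2 A) ->
  measurable_fun setT f -> (forall x, 0 <= f x) ->
  (\int[m1]_x (f (g x))%:E = \int[m2]_x (f x)%:E)%E.
Proof.
move=> mg m12 mf f0.
have <- : (\int[pushforward m1 g]_x (f x)%:E = \int[m2]_x (f x)%:E)%E.
  by apply: eq_measure_integral => mg' A mA; exact: m12.
rewrite ge0_integral_pushforward//; first exact/measurable_EFinP.
by move=> x _; rewrite lee_fin.
Qed.

Section lebesgueR.
Context {R : realType}.
Notation lambda := (@completed_lebesgue_measure R).

Lemma measurable_id_lebesgueR :
  measurable_fun setT (fun x : lebesgueR R => x : measurableTypeR R).
Proof. by move=> _ A mA; rewrite setTI; exact: sub_caratheodory. Qed.

Lemma ge0_integral_lebesgueR (f : R -> R) : measurable_fun setT f ->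
  (forall x, 0 <= f x) ->
  (\int[lambda]_x (f x)%:E = \int[@lebesgue_measure R]_x (f x)%:E)%E.
Proof.
move=> mf f0.
have := @ge0_integral_image_measure _ _ _ _ _ lambda (@lebesgue_measure R) _ f
  measurable_id_lebesgueR.
by apply.
Qed.

Lemma continuous_exp_norm (c : R) : continuous (fun x : R => expR (- (c * `|x|))).
Proof.
move=> x; apply: (@continuous_comp _ _ _ (fun x => - (c * `|x|)) expR); last first.
  exact: continuous_expR.
by apply: cvgN; apply: cvgM; [exact: cvg_cst|exact: norm_continuous].
Qed.

(** By symmetry the integral is twice that over the half-line, where the integrand is [c^-1] times
    the density of the exponential law. *)
Lemma integrable_exp_norm (c : R) : 0 < c ->
  lambda.-integrable setT
    (EFin \o (fun x : lebesgueR R => expR (- (c * `|x : R|)))).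
Proof.
move=> c0; have cf := @continuous_exp_norm c.
have mf := continuous_measurable_fun cf.
apply/integrableP; split.
  apply/measurable_EFinP; apply: (measurableT_comp mf).
  exact: measurable_id_lebesgueR.
under eq_integral do rewrite gee0_abs ?lee_fin ?expR_ge0//.
rewrite (ge0_integral_lebesgueR mf) => [|x]; last exact: expR_ge0.
rewrite ge0_symfun_integralT//; last by move=> x /=; rewrite normrN.
rewrite -set_itvcy.
have fi : lebesgue_measure.-integrable `[0, +oo[
    (EFin \o (fun x : R => expR (- (c * `|x|)))).
  apply: (@eq_integrable _ _ _ (@lebesgue_measure R) `[0, +oo[%classic _
      (fun x => (c^-1)%:E * (exponential_pdf c x)%:E)%E) => //.
    move=> x; rewrite inE/= in_itv/= andbT => x0.
    rewrite exponential_pdfE// -EFinM mulrA mulVf ?gt_eqF// mul1r.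
    by rewrite ger0_norm// mulNr.
  apply: integrableZl => //.
  apply: (integrableS measurableT) => //.
  exact: integrable_exponential_pdf.
rewrite -ge0_fin_numE; last first.
  by rewrite mule_ge0// integral_ge0// => x _; rewrite lee_fin expR_ge0.
by rewrite fin_numM// integrable_fin_num.
Qed.

(** It suffices that [h] integrates to 0 over every Lebesgue measurable set; multipliers give this
    for Borel sets. *)
Lemma null_moments_ae_eq0 (b : R) (h : lebesgueR R -> R) : 0 < b ->
  null_moments lambda (fun x : lebesgueR R => x : R) b h ->
  {ae lambda, forall x, h x = 0}.
Proof.
move=> b0 h0.
have mX : measurable_fun setT (fun x : lebesgueR R => x : R).
  exact: measurable_id_lebesgueR.
have [hi _] := null_moments_null mX b0 0 h0.
have {}hi : lambda.-integrable setT (EFin \o h).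
  by apply: eq_integrable hi => // x _ /=; rewrite mul1r.
suff [N [mN N0 hN]] : ae_eq lambda setT (EFin \o h) (cst 0%E).
  exists N; split => // x /= hx; apply: hN => /= hx0; apply: hx.
  by have [] := hx0 I.
apply: integral_ae_eq => // E _ mE.
rewrite [RHS]integral0.
(* A Lebesgue measurable set differs from a Borel set by a null set. *)
have : (completed_algebra_gen (@lebesgue_measure R)).-sigma.-measurable E.
  by rewrite completed_caratheodory_measurable.
rewrite g_sigma_completed_algebra_genE => -[B mB [N [A [mA A0 NA]] BN]].
have mA' : measurable (A : set (lebesgueR R)) by exact: sub_caratheodory.
have mB' : measurable (B : set (lebesgueR R)) by exact: sub_caratheodory.
have hiS (F : set (lebesgueR R)) : measurable F ->
  lambda.-integrable F (EFin \o h) by move=> mF; exact: integrableS hi.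
rewrite (@negligible_integral _ _ _ _ E (A : set (lebesgueR R)))//; last exact: hiS.
(* Here [E] is the union of [B] and [N], and [N] lies in the Borel null set [A]. Removing [A]
   changes no integral and makes [E] and [B] coincide. *)
have -> : E `\` A = B `\` A.
  rewrite -BN; apply/seteqP; split=> x [Bx Ax]; split => //; last by left.
  by case: Bx => // /NA.
rewrite -negligible_integral//; last exact: hiS.
exact: (null_moments_preimage mX b0 h0 mB).
Qed.

End lebesgueR.

(** * Real and imaginary parts of complex integrands *)

Section complex_parts.
Context {R : realType}.
Implicit Types z : R[i].

Lemma normr_Re_le_normc z : `|complex.Re z| <= Normc.normc z.
Proof. by case: z => p q /=; rewrite -sqrtr_sqr ler_wsqrtr// lerDl sqr_ge0. Qed.

Lemma normr_Im_le_normc z : `|complex.Im z| <= Normc.normc z.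
Proof. by case: z => p q /=; rewrite -sqrtr_sqr ler_wsqrtr// lerDr sqr_ge0. Qed.

Lemma normc_ge0 z : 0 <= Normc.normc z.
Proof. exact: le_trans (normr_Re_le_normc z). Qed.

Lemma Re_realM (x : R) z (y : R) :
  complex.Re (x%:C * z * y%:C) = x * (complex.Re z * y).
Proof. by case: z => p q /=; ring. Qed.

Lemma Im_realM (x : R) z (y : R) :
  complex.Im (x%:C * z * y%:C) = x * (complex.Im z * y).
Proof. by case: z => p q /=; ring. Qed.

Section integrable_parts.
Context d (T : measurableType d) (mu : {measure set T -> \bar R}).
Implicit Type f : T -> R[i].

Lemma measurable_normc f : cmeasurable f ->
  measurable_fun setT (fun x => Normc.normc (f x)).
Proof.
move=> [mr mi].
rewrite (_ : (fun _ => _) = fun x =>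
    Num.sqrt (complex.Re (f x) ^+ 2 + complex.Im (f x) ^+ 2)); last first.
  by apply/funext => x; case: (f x).
apply: measurableT_comp.
  exact: continuous_measurable_fun (@sqrt_continuous R).
by apply: measurable_funD; exact: measurable_funX.
Qed.

Lemma cintegrable_normc f : cintegrable mu f ->
  mu.-integrable setT (EFin \o (fun x => Normc.normc (f x))).
Proof.
move=> [mf foo]; apply/integrableP; split.
  by apply/measurable_EFinP; exact: measurable_normc.
by under eq_integral do rewrite gee0_abs ?lee_fin ?normc_ge0//.
Qed.

Lemma cintegrable_Re f : cintegrable mu f ->
  mu.-integrable setT (EFin \o (fun x => complex.Re (f x))).
Proof.
move=> fi; apply: le_integrable_EFin (cintegrable_normc fi); first exact: fi.1.1.
by move=> x; exact: normr_Re_le_normc.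
Qed.

Lemma cintegrable_Im f : cintegrable mu f ->
  mu.-integrable setT (EFin \o (fun x => complex.Im (f x))).
Proof.
move=> fi; apply: le_integrable_EFin (cintegrable_normc fi); first exact: fi.1.2.
by move=> x; exact: normr_Im_le_normc.
Qed.

(** Here [u] is meant to be the real or imaginary part of [f]; its weighted square is dominated by
    that of the modulus. *)
Lemma L2_weight_part_integrable (w u : T -> R) f :
  L2_weight mu w f -> measurable_fun setT w -> (forall x, 0 <= w x) ->
  measurable_fun setT u -> (forall x, `|u x| <= Normc.normc (f x)) ->
  mu.-integrable setT (EFin \o (fun x => u x ^+ 2 * w x)).
Proof.
move=> [mf foo] mw w0 u_meas uf.
have mu2w : measurable_fun setT (fun x => u x ^+ 2 * w x).
  by apply: measurable_funM => //; exact: measurable_funX.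
apply: (@le_integrable_EFin _ _ _ _ _
    (fun x => Normc.normc (f x) ^+ 2 * w x)) => //.
  move=> x; rewrite normrM (ger0_norm (w0 x)) ler_wpM2r//.
  by rewrite normrX lerXn2r ?nnegrE ?normc_ge0.
apply/integrableP; split.
  apply/measurable_EFinP; apply: measurable_funM => //.
  by apply: measurable_funX; exact: measurable_normc.
by under eq_integral => x _ do
  rewrite gee0_abs ?lee_fin ?(mulr_ge0 (sqr_ge0 _) (w0 x))//.
Qed.

End integrable_parts.
End complex_parts.

(** * The determinacy statement for real functions *)

Section weighted.
Context {R : realType}.
Notation lambda := (@completed_lebesgue_measure R).
Variables (phi : R -> R) (a C : R).
Hypotheses (mphi : measurable_fun setT (phi : lebesgueR R -> R))
  (phi_gt0 : forall x, 0 < phi x)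
  (a0 : 0 < a) (phi_decay : forall x, phi x <= C * expR (- (a * `|x|))).

(** The preceding results apply to [u * phi], and [phi] can be cancelled because it is positive. *)
Lemma weighted_moments_ae_eq0 (u : lebesgueR R -> R) :
  measurable_fun setT u ->
  lambda.-integrable setT (EFin \o (fun x : lebesgueR R => u x ^+ 2 * phi x)) ->
  (forall n, \int[lambda]_x ((x : R) ^+ n * (u x * phi x)) = 0) ->
  {ae lambda, forall x, u x = 0}.
Proof.
move=> mu ui u0; have a40 : 0 < a / 4 by rewrite divr_gt0.
suff : {ae lambda, forall x : lebesgueR R, u x * phi x = 0}.
  apply: filterS => x /eqP; rewrite mulf_eq0 (gt_eqF (phi_gt0 x)) orbF.
  by move=> /eqP.
apply: (null_moments_ae_eq0 a40); split => //.
(* With [E = expR (a / 4 * |x|)], the majorant comes from [|u| * E <= u ^+ 2 + E ^+ 2] multiplied by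
   [phi]. As [E ^+ 2] uses up only half of the decay of [phi], an integrable exponential remains. *)
apply: (@le_integrable_EFin _ _ _ _ _ (fun x : lebesgueR R =>
    u x ^+ 2 * phi x + C * expR (- (a / 2 * `|x : R|)))).
- apply: measurable_funM; first exact: measurable_funM.
  by apply: measurable_exp_norm; exact: measurable_id_lebesgueR.
- move=> x; set E := expR (a / 4 * _); have E0 : 0 < E by exact: expR_gt0.
  rewrite normrM normrM (gtr0_norm (phi_gt0 x)) (gtr0_norm E0).
  have uE : `|u x| * E <= u x ^+ 2 + E ^+ 2.
    by rewrite -(real_normK (num_real (u x))); nra.
  apply: (@le_trans _ _ (u x ^+ 2 * phi x + phi x * E ^+ 2)).
    by rewrite mulrAC [phi x * _]mulrC -mulrDl ler_wpM2r// ltW.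
  rewrite lerD2l.
  have -> : expR (- (a / 2 * `|x : R|)) = expR (- (a * `|x : R|)) * E ^+ 2.
    by rewrite expr2 -!expRD; congr expR; field.
  by rewrite mulrA ler_wpM2r// sqr_ge0.
- rewrite (_ : _ \o _ = (EFin \o (fun x => u x ^+ 2 * phi x)%R) \+
    (fun x : lebesgueR R => C%:E * (expR (- (a / 2 * `|x : R|)))%:E))%E//.
  apply: integrableD => //; apply: integrableZl => //.
  by apply: integrable_exp_norm; rewrite divr_gt0.
Qed.

End weighted.

Theorem theorem6p4 (R : realType) (phi : R -> R)
  (phi_schwartz : schwartz phi)
  (phi_gt0 : forall x : R, 0 < phi x)
  (phi_exp_decay : exists a C : R, [/\ 0 < a, 0 < C &
     forall x : R, phi x <= C * expR (- (a * `|x|))])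
  (f1 f2 : lebesgueR R -> R[i])
  (mf1 : cmeasurable f1)
  (mf2 : cmeasurable f2)
  (f12_L2 : L2_weight completed_lebesgue_measure phi (fun x => f1 x - f2 x))
  (if1 : forall n : nat, cintegrable completed_lebesgue_measure
     (fun x : lebesgueR R => (x : R)%:C ^+ n * f1 x * (phi x)%:C))
  (if2 : forall n : nat, cintegrable completed_lebesgue_measure
     (fun x : lebesgueR R => (x : R)%:C ^+ n * f2 x * (phi x)%:C))
  (moments : forall n : nat,
     cintegral completed_lebesgue_measure
       (fun x : lebesgueR R => (x : R)%:C ^+ n * f1 x * (phi x)%:C) =
     cintegral completed_lebesgue_measure
       (fun x : lebesgueR R => (x : R)%:C ^+ n * f2 x * (phi x)%:C)) :
  {ae completed_lebesgue_measure, forall x : lebesgueR R, f1 x = f2 x}.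
Proof.
have [a [C [a0 _ phi_decay]]] := phi_exp_decay.
have mphi : measurable_fun setT (phi : lebesgueR R -> R).
  (* The derivative of order 0 is [phi] itself, so smoothness yields continuity and hence Borel
     measurability. *)
  apply: (measurableT_comp _ measurable_id_lebesgueR).
  apply: continuous_measurable_fun => x.
  apply: differentiable_continuous; apply/derivable1_diffP.
  exact: phi_schwartz.1 0%N x.
have [mf12 _] := f12_L2.
(* The argument is run once for an abstract [p], later taken to be the real and then the imaginary
   part. *)
have part_eq0 (p : R[i] -> R)
    (pM : forall x z y, p (x%:C * z * y%:C) = x * (p z * y))
    (pB : forall z1 z2, p (z1 - z2) = p z1 - p z2)
    (p_le : forall z, `|p z| <= Normc.normc z)
    (mp : measurable_fun setT (fun x => p (f1 x - f2 x)))
    (ip1 : forall n, completed_lebesgue_measure.-integrable setT (EFin \o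
       (fun x : lebesgueR R => p ((x : R)%:C ^+ n * f1 x * (phi x)%:C))))
    (ip2 : forall n, completed_lebesgue_measure.-integrable setT (EFin \o
       (fun x : lebesgueR R => p ((x : R)%:C ^+ n * f2 x * (phi x)%:C))))
    (eqp : forall n, \int[completed_lebesgue_measure]_x
        p ((x : R)%:C ^+ n * f1 x * (phi x)%:C) =
      \int[completed_lebesgue_measure]_x
        p ((x : R)%:C ^+ n * f2 x * (phi x)%:C)) :
    {ae completed_lebesgue_measure, forall x, p (f1 x - f2 x) = 0}.
  apply: (weighted_moments_ae_eq0 mphi phi_gt0 a0 phi_decay mp).
    apply: (L2_weight_part_integrable f12_L2) => // x; exact: ltW.
  (* Zero is written as the difference of the two equal moments, which are merged by linearity of
     the integral. *)
  move=> n; rewrite -[RHS](subrr (\int[completed_lebesgue_measure]_x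
        p ((x : R)%:C ^+ n * f1 x * (phi x)%:C))) {2}eqp -RintegralB//.
  by apply: eq_Rintegral => x _; rewrite -!rmorphXn !pM pB; ring.
have Re0 : {ae completed_lebesgue_measure,
    forall x, complex.Re (f1 x - f2 x) = 0}.
  apply: (part_eq0 (fun z => complex.Re z)) => [x z y|[? ?] [? ?]|z||n|n|n] //.
  - exact: Re_realM.
  - exact: normr_Re_le_normc.
  - exact: mf12.1.
  - exact: cintegrable_Re.
  - exact: cintegrable_Re.
  - by have [] := moments n.
have Im0 : {ae completed_lebesgue_measure,
    forall x, complex.Im (f1 x - f2 x) = 0}.
  apply: (part_eq0 (fun z => complex.Im z)) => [x z y|[? ?] [? ?]|z||n|n|n] //.
  - exact: Im_realM.
  - exact: normr_Im_le_normc.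
  - exact: mf12.2.
  - exact: cintegrable_Im.
  - exact: cintegrable_Im.
  - by have [] := moments n.
apply: filterS2 Re0 Im0 => x Rex Imx; apply/eqP; rewrite -subr_eq0.
by rewrite eq_complex Rex Imx /= eqxx.
Qed.
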